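(* Let $\alpha\in(0,1]$ and let $g:\mathbb{R}\to\mathbb{R}$ be a function such that the bivariate function $(x,y)\mapsto g(x+y)-g(x)-g(y)$ on $\mathbb{R}^2$ is locally Hölder continuous with exponent $\alpha$, i.e. belongs to $H_\alpha^{(loc)}(\mathbb{R}^2)$. Then there exist a function $f\in H_\alpha^{(loc)}(\mathbb{R})$ and an additive function $A:\mathbb{R}\to\mathbb{R}$ such that $g=f+A$.
   Context: A function $A:\mathbb{R}\to\mathbb{R}$ is additive if $A(x+y)=A(x)+A(y)$ for all $x,y\in\mathbb{R}$ (no regularity is assumed). For $s\ge 1$, a set $\Omega\subset\mathbb{R}^s$ and a real-valued function $f$ defined on (a set containing) $\Omega$, the modulus of continuity of $f$ on $\Omega$ is $$\omega(f;\delta;\Omega)=\sup\{|f(\mathbf{x})-f(\mathbf{y})| : \mathbf{x},\mathbf{y}\in\Omega,\ |\mathbf{x}-\mathbf{y}|\le\delta\},\qquad 0\le\delta\le \operatorname{diam}\Omega,$$ where $|\cdot|$ is the Euclidean norm on $\mathbb{R}^s$. The class $H_\alpha^{(loc)}(\mathbb{R}^s)$ of locally Hölder continuous functions with exponent $\alpha$ consists of all functions $f:\mathbb{R}^s\to\mathbb{R}$ such that for every compact set $\Omega\subset\mathbb{R}^s$ there is a constant $K$ (depending on $\Omega$) with $\omega(f;\delta;\Omega)\le K\delta^\alpha$ for all $0\le\delta\le\operatorname{diam}\Omega$. *)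

(* Defs.v *)
From mathcomp Require Import all_boot all_order all_algebra.
From mathcomp Require Import all_classical all_reals all_analysis.

Set Implicit Arguments.
Unset Strict Implicit.
Unset Printing Implicit Defensive.

Import Order.TTheory GRing.Theory Num.Theory.
Import numFieldNormedType.Exports.

Local Open Scope classical_set_scope.
Local Open Scope ring_scope.

(* The norm `|x| that the library puts on 'rV[R]_s is the max norm, hence this
   separate definition; the topologies, and so the compact sets, agree. *)
Definition euclidean_norm (R : realType) (s : nat) (x : 'rV[R]_s) : R :=
  Num.sqrt (\sum_(i < s) x ord0 i ^+ 2).

(* The suprema below are taken in \bar R because the real-valued sup of an
   unbounded set is 0 by convention; ereal_sup set0 = -oo. *)
Definition diam (R : realType) (s : nat) (Omega : set 'rV[R]_s) : \bar R :=
  ereal_sup [set r | exists x y, [/\ Omega x, Omega y &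
    r = (euclidean_norm (x - y))%:E]].

Definition modulus_of_continuity (R : realType) (s : nat)
    (f : 'rV[R]_s -> R) (delta : R) (Omega : set 'rV[R]_s) : \bar R :=
  ereal_sup [set r | exists x y, [/\ Omega x, Omega y,
    euclidean_norm (x - y) <= delta & r = `|f x - f y|%:E]].

Definition locally_holder (R : realType) (s : nat) (alpha : R)
    (f : 'rV[R]_s -> R) : Prop :=
  forall Omega : set 'rV[R]_s, compact Omega ->
  exists K : R, forall delta : R, 0 <= delta -> (delta%:E <= diam Omega)%E ->
    (modulus_of_continuity f delta Omega <= (K * delta `^ alpha)%:E)%E.

(* R identified with the space of row vectors of length 1. *)
Definition locally_holder1 (R : realType) (alpha : R) (f : R -> R) : Prop :=
  locally_holder alpha (fun v : 'rV[R]_1 => f (v ord0 ord0)).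

(* R x R identified with the space of row vectors of length 2. *)
Definition locally_holder2 (R : realType) (alpha : R) (F : R -> R -> R) : Prop :=
  locally_holder alpha (fun v : 'rV[R]_2 => F (v ord0 ord0) (v ord0 ord_max)).

(* Main.v *)
Require Import Defs.
From mathcomp Require Import all_boot all_order all_algebra.
From mathcomp Require Import all_classical all_reals all_analysis.
From mathcomp Require Import ring lra.

Set Implicit Arguments.
Unset Strict Implicit.
Unset Printing Implicit Defensive.

Import Order.TTheory GRing.Theory Num.Theory.
Import numFieldNormedType.Exports.

Local Open Scope classical_set_scope.
Local Open Scope ring_scope.

(** Write F x y = g (x + y) - g x - g y for the Cauchy difference of g.  It is
    symmetric, and associativity of addition gives the cocycle identity
      F x y + F (x + y) z = F x (y + z) + F y z.
    It suffices to find a locally Hoelder f with the same Cauchy difference as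
    g: then g - f is additive.

    Such an f comes from averaging the cocycle identity over z in [0, 1]. The
    sections F x are continuous, so each has a primitive G x
    ([continuous_primitive]), and the average of F x is
    phi x = G x 1 - G x 0.  The averaged identity reads
      F x y + phi (x + y) = (G x (y + 1) - G x y) + phi y.
    The first term on the right is the average of F x over [y, y + 1]; its
    derivative in y is F x (y + 1) - F x y = F 1 (x + y) - F 1 y, which
    integrates to G 1 (x + y) - G 1 y up to a constant fixed at y = 0.
    Substituting, F is the Cauchy difference of f = G 1 - G 1 0 - phi
    ([cauchy_difference_average]).  In this form the argument uses primitives
    only: both identities say that a function with zero derivative is
    constant.

    The regularity of f splits accordingly. G 1 is continuously
    differentiable, hence locally Hoelder of every exponent at most 1
    ([is_derive_holder_itv]).  By the mean value theorem applied to
    G x - G y, the difference phi x - phi y equals F x c - F y c for some c in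
    [0, 1], so phi inherits the Hoelder constant of F on a box
    ([average_holder_itv]). *)

(** * Hoelder conditions on boxes and intervals *)

Lemma euclidean_norm_ge0 (R : realType) (s : nat) (x : 'rV[R]_s) :
  0 <= euclidean_norm x.
Proof. exact: sqrtr_ge0. Qed.

Lemma euclidean_norm1 (R : realType) (x : 'rV[R]_1) :
  euclidean_norm x = `|x ord0 ord0|.
Proof. by rewrite /euclidean_norm big_ord1 sqrtr_sqr. Qed.

(** Boxes are compact, and delta := euclidean_norm (u - v) is an admissible
    radius, being at most the diameter; this turns the condition on suprema
    into a pointwise inequality. *)
Lemma locally_holder_box (R : realType) (s : nat) (alpha : R)
    (f : 'rV[R]_s -> R) (M : R) :
  locally_holder alpha f ->
  exists2 K : R, 0 <= K & forall u v : 'rV[R]_s,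
    (forall i, `|u ord0 i| <= M) -> (forall i, `|v ord0 i| <= M) ->
    `|f u - f v| <= K * euclidean_norm (u - v) `^ alpha.
Proof.
move=> hf; pose box := [set v : 'rV[R]_s | forall i, `[- M, M]%classic (v ord0 i)].
have cbox : compact box.
  apply: (@rV_compact R s (fun=> `[- M, M]%classic)) => _.
  exact: segment_compact.
have [K HK] := hf _ cbox; exists (Num.max K 0).
  by rewrite le_max lexx orbT.
move=> u v uM vM.
have boxu : box u by move=> i; rewrite /= in_itv /= -ler_norml.
have boxv : box v by move=> i; rewrite /= in_itv /= -ler_norml.
have := HK (euclidean_norm (u - v)) (euclidean_norm_ge0 _).
have -> : ((euclidean_norm (u - v))%:E <= diam box)%E.
  by apply: ereal_sup_ubound; exists u, v.
move=> /(_ isT) le_mod.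
have : (`|f u - f v|%:E <= (K * euclidean_norm (u - v) `^ alpha)%:E)%E.
  by apply: le_trans le_mod; apply: ereal_sup_ubound; exists u, v.
rewrite lee_fin => /le_trans; apply.
by rewrite ler_wpM2r ?powR_ge0// le_max lexx.
Qed.

Definition holder_itv (R : realType) (alpha M K : R) (f : R -> R) : Prop :=
  forall x y, `|x| <= M -> `|y| <= M -> `|f x - f y| <= K * `|x - y| `^ alpha.

(** A compact set of row vectors of length 1 has bounded coordinates, so symmetric
    intervals are enough. *)
Lemma locally_holder1_itv (R : realType) (alpha : R) (f : R -> R) :
  0 <= alpha ->
  (forall M, exists2 K : R, 0 <= K & holder_itv alpha M K f) ->
  locally_holder1 alpha f.
Proof.
move=> alpha_ge0 hf Omega cOmega.
have cOmega0 : compact ((fun v : 'rV[R]_1 => v ord0 ord0) @` Omega).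
  apply: continuous_compact cOmega; apply: continuous_subspaceT.
  exact: coord_continuous.
have [M [_ /(_ (M + 1))]] := compact_bounded cOmega0.
rewrite ltrDl ltr01 => /(_ isT) OmegaM.
have [K K_ge0 hK] := hf (M + 1); exists K => delta delta_ge0 _.
apply: ge_ereal_sup => _ [x [y [Ox Oy xy ->]]].
rewrite lee_fin.
have coordM (z : 'rV[R]_1) : Omega z -> `|z ord0 ord0| <= M + 1.
  by move=> Oz; apply: OmegaM; exists z.
apply: le_trans (hK _ _ (coordM _ Ox) (coordM _ Oy)) _.
apply: ler_wpM2l => //; apply: ge0_ler_powR; rewrite ?nnegrE//.
by move: xy; rewrite euclidean_norm1 !mxE.
Qed.

(** The radius d solves (K + 1) * d `^ alpha = e; the 1 added to K covers
    K = 0. *)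
Lemma holder_itv_continuous (R : realType) (alpha : R) (f : R -> R) :
  0 < alpha ->
  (forall M, exists2 K : R, 0 <= K & holder_itv alpha M K f) ->
  continuous f.
Proof.
move=> alpha_gt0 hf x; have [K K_ge0 hK] := hf (`|x| + 1).
apply/cvgrPdist_le => e e_gt0.
pose d := (e / (K + 1)) `^ alpha^-1.
have d_gt0 : 0 < d by rewrite powR_gt0// divr_gt0// ltr_wpDl.
have dE : d `^ alpha = e / (K + 1).
  by rewrite /d -powRrM mulVf ?gt_eqF// powRr1// divr_ge0 ?addr_ge0// ltW.
near=> y.
have xy1 : `|x - y| <= 1 by near: y; exact: cvgr_dist_le.
have xyd : `|x - y| <= d by near: y; exact: cvgr_dist_le.
apply: le_trans (hK _ _ _ _) _.
- by rewrite lerDl.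
- have -> : y = x - (x - y) by rewrite opprB addrC subrK.
  by rewrite (le_trans (ler_normB _ _))// lerD2l.
- apply: (@le_trans _ _ (K * (e / (K + 1)))).
    rewrite -dE; apply: ler_wpM2l => //; apply: ge0_ler_powR => //.
    by rewrite ltW.
    by rewrite nnegrE ltW.
  by rewrite mulrA ler_pdivrMr ?ltr_wpDl// mulrDr mulr1 mulrC lerDl ltW.
Unshelve. all: by end_near. Qed.

(** * Primitives *)

(** The candidate is the integral from 0 to x, with the usual sign convention for
    x < 0: of the two integrals defining P, one is over an empty interval.
    The fundamental theorem of calculus is available for integrals from a
    fixed left endpoint a, so around x the function P is rewritten with some a
    below both 0 and x. *)
Lemma continuous_primitive (R : realType) (f : R -> R) :
  continuous f -> exists P : R -> R, forall x : R, is_derive x 1 P (f x).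
Proof.
move=> cf; pose mu := @lebesgue_measure R.
have intf a b : mu.-integrable `[a, b] (EFin \o f).
  apply: continuous_compact_integrable; first exact: segment_compact.
  exact: continuous_subspaceT.
pose P x := (\int[mu]_(t in `]0%R, x]) f t - \int[mu]_(t in `]x, 0%R]) f t)%R.
have PE a x : a <= 0 -> a <= x ->
    P x = (\int[mu]_(t in `[a, x]) f t - \int[mu]_(t in `[a, 0%R]) f t)%R.
  move=> a0 ax; rewrite /P; have [x0|x0] := leP 0 x.
    rewrite [X in _ - X](_ : _ = 0) ?subr0; last first.
      by rewrite set_itv_ge ?Rintegral_set0// bnd_simp -leNgt.
    by rewrite -(@Rintegral_itvB _ _ (BLeft a) (BRight x) 0) ?bnd_simp.
  rewrite [X in X - _](_ : _ = 0) ?sub0r; last first.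
    by rewrite set_itv_ge ?Rintegral_set0// bnd_simp -leNgt ltW.
  rewrite -(@Rintegral_itvB _ _ (BLeft a) (BRight 0) x) ?bnd_simp ?(ltW x0)//.
  by rewrite opprB.
exists P => x.
pose a := Num.min 0 x - 1.
have a0 : a < 0 by rewrite /a ltrBlDr gt_min add0r ltr01.
have ax : a < x by rewrite /a ltrBlDr gt_min ltrDl ltr01 orbT.
have xx1 : x < x + 1 by rewrite ltrDl.
have [dI dIE] := @continuous_FTC1_closed _ f a x (x + 1) xx1 (intf _ _) ax (cf x).
pose I y : R := (\int[mu]_(t in `[a, y]) f t)%R.
have IP : is_derive x 1 I (f x).
  by split; [exact: dI|rewrite -derive1E; exact: dIE].
apply: (@near_eq_is_derive _ _ _ (fun y => I y - I 0)).
  near=> y; rewrite (PE a)// ?ltW//.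
  by near: y; exact: lt_nbhsr.
by apply: is_derive_eq; rewrite subr0.
Unshelve. all: by end_near. Qed.

(** The mean value theorem gives a Lipschitz bound, and on an interval of
    length 2 M a distance d is at most (2 M) `^ (1 - alpha) * d `^ alpha. *)
Lemma is_derive_holder_itv (R : realType) (alpha : R) (p P : R -> R) :
  0 <= alpha <= 1 -> continuous p -> (forall x : R, is_derive x 1 P (p x)) ->
  forall M, exists2 K : R, 0 <= K & holder_itv alpha M K P.
Proof.
move=> /andP[alpha_ge0 alpha_le1] cp dP M.
have cpM : compact (p @` `[- M, M]).
  apply: continuous_compact; last exact: segment_compact.
  exact: continuous_subspaceT.
have [B [_ /(_ (B + 1))]] := compact_bounded cpM.
rewrite ltrDl ltr01 => /(_ isT) pB.
exists (`|B + 1| * (2 * `|M|) `^ (1 - alpha)); first by rewrite mulr_ge0 ?powR_ge0.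
move=> x y; wlog xy : x y / x <= y => [hwlog xM yM|].
  have [|/ltW yx] := leP x y; first by move=> /hwlog; exact.
  by rewrite distrC (distrC x); exact: hwlog.
move=> xM yM.
have cP : {within `[x, y], continuous P}.
  by apply: derivable_within_continuous => z _; case: (dP z).
have [c /[!in_itv]/= /andP[xc cy] PE] := MVT_segment xy (fun z _ => dP z) cP.
rewrite distrC PE normrM (distrC x) -mulrA; apply: ler_pM => //.
  apply: le_trans (ler_norm _); apply: pB; exists c => //=.
  rewrite in_itv/=; move: xM yM; rewrite !ler_norml; lra.
have [->|yx_neq0] := eqVneq (y - x) 0.
  by rewrite normr0 mulr_ge0 ?powR_ge0.
rewrite -[X in X <= _](@powRr1 R)// -{1}(subrK alpha 1) powRD; last first.
  by rewrite normr_eq0 yx_neq0 implybT.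
apply: ler_wpM2r; first exact: powR_ge0.
apply: ge0_ler_powR; rewrite ?nnegrE ?subr_ge0 ?mulr_ge0//.
apply: le_trans (ler_normB _ _) _.
by have := ler_norm M; lra.
Qed.

Lemma is_derive_comp_shift (R : realType) (P p : R -> R) (c x : R) :
  (forall y : R, is_derive y 1 P (p y)) ->
  is_derive x 1 (fun y => P (y + c)) (p (x + c)).
Proof.
move=> dP; rewrite -[p _]mulr1.
by apply: (@is_derive1_comp _ P (shift c)); exact: is_derive_shift.
Qed.

(** Averages of F x over z in [0, 1] are differences of values of a primitive
    G x, which the mean value theorem turns back into values of F. *)
Lemma average_holder_itv (R : realType) (alpha M K : R) (F G : R -> R -> R) :
  (forall x y : R, is_derive y 1 (G x) (F x y)) ->
  (forall z, 0 <= z <= 1 -> holder_itv alpha M K (F ^~ z)) ->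
  holder_itv alpha M K (fun x => G x 1 - G x 0).
Proof.
move=> dG hF x y xM yM.
pose H z := G x z - G y z.
have dH (z : R) : is_derive z 1 H (F x z - F y z) by apply: is_derive_eq.
have cH : {within `[0, 1], continuous H}.
  by apply: derivable_within_continuous => z _; case: (dH z).
have [c /[!in_itv]/= c01 HE] := MVT_segment ler01 (fun z _ => dH z) cH.
have -> : G x 1 - G x 0 - (G y 1 - G y 0) = F x c - F y c.
  by move: HE; rewrite subr0 mulr1 => <-; rewrite /H; lra.
exact: hF.
Qed.

(** * The Cauchy difference *)

Definition cauchy_difference (R : realType) (g : R -> R) (x y : R) : R :=
  g (x + y) - g x - g y.

Lemma cauchy_differenceC (R : realType) (g : R -> R) (x y : R) :
  cauchy_difference g x y = cauchy_difference g y x.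
Proof. by rewrite /cauchy_difference (addrC x) addrAC. Qed.

(** By symmetry it is enough to vary the first variable. *)
Lemma cauchy_difference_holder_itv (R : realType) (alpha : R) (g : R -> R) :
  locally_holder2 alpha (cauchy_difference g) ->
  forall M, exists2 K : R, 0 <= K & forall z, `|z| <= M ->
    holder_itv alpha M K (cauchy_difference g ^~ z).
Proof.
move=> hg M; have [K K_ge0 hK] := locally_holder_box M hg.
exists K => // z zM x y xM yM.
pose pt t : 'rV[R]_2 := \row_i (if i == ord0 then t else z).
have ptM t : `|t| <= M -> forall i, `|pt t ord0 i| <= M.
  by move=> tM i; rewrite mxE; case: ifP.
have := hK (pt x) (pt y) (ptM _ xM) (ptM _ yM).
rewrite !mxE/= /euclidean_norm big_ord_recr big_ord1 /= !mxE /=.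
by rewrite subrr expr0n addr0 sqrtr_sqr.
Qed.

(** The function G x 1 - G x 0 is the average phi of F x over [0, 1]. [Fphi] is
    the cocycle identity integrated over z in [0, 1]; [Gphi] evaluates the
    average of F x over [y, y + 1] by integrating its derivative in y. *)
Lemma cauchy_difference_average (R : realType) (g : R -> R) (G : R -> R -> R) :
  (forall x y : R, is_derive y 1 (G x) (cauchy_difference g x y)) ->
  forall x y, cauchy_difference (fun x => G 1 x - G 1 0 - (G x 1 - G x 0)) x y
    = cauchy_difference g x y.
Proof.
move=> dG x y; pose F := cauchy_difference g.
have FE u v : F u v = g (u + v) - g u - g v by [].
have Fphi : F x y + (G (x + y) 1 - G (x + y) 0)
    = G x (y + 1) - G x y + (G y 1 - G y 0).
  pose H z := z * F x y + G (x + y) z - G x (z + y) - G y z.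
  have dH (z : R) : is_derive z 1 H 0.
    have dGxy := is_derive_comp_shift y z (dG x).
    apply: is_derive_eq.
    by rewrite scaler0 [_%:A]mulr1 add0r -/F !FE (addrC z) !addrA; ring.
  have := @is_derive_0_is_cst R H 1 0 dH.
  by rewrite /H mul1r mul0r !add0r (addrC 1); lra.
have Gphi : G x 1 - G x 0 - G 1 x + G 1 0
    = G x (y + 1) - G x y - G 1 (x + y) + G 1 y.
  pose H z := G x (z + 1) - G x z - G 1 (z + x) + G 1 z.
  have dH (z : R) : is_derive z 1 H 0.
    have dGx := is_derive_comp_shift 1 z (dG x).
    have dG1 := is_derive_comp_shift x z (dG 1).
    apply: is_derive_eq; rewrite -/F !FE.
    by rewrite (addrC 1 z) (addrC 1 (z + x)) (addrC z x) !addrA; ring.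
  have := @is_derive_0_is_cst R H 0 y dH.
  by rewrite /H !add0r (addrC y x); lra.
by rewrite -/F; move: Fphi Gphi; rewrite /cauchy_difference; lra.
Qed.

Unset Implicit Arguments.

Theorem theorem2p1 (R : realType) (alpha : R) (g : R -> R)
    (alpha_gt0 : 0 < alpha) (alpha_le1 : alpha <= 1)
    (hg : locally_holder2 alpha (fun x y : R => g (x + y) - g x - g y)) :
  exists f A : R -> R,
    [/\ locally_holder1 alpha f,
        (forall x y : R, A (x + y) = A x + A y) &
        forall x : R, g x = f x + A x].
Proof.
have {}hg : locally_holder2 alpha (cauchy_difference g) by [].
have holderF := cauchy_difference_holder_itv hg.
have contF x : continuous (cauchy_difference g x).
  apply: (@holder_itv_continuous R alpha) => // M.
  (* The interval has to contain the fixed variable x as well. *)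
  have [K K_ge0 hK] := holderF (Num.max M `|x|); exists K => // y z yM zM.
  by rewrite !(cauchy_differenceC g x); apply: hK;
    rewrite le_max ?yM ?zM ?lexx ?orbT.
have [G dG] := choice (fun x => continuous_primitive (contF x)).
pose phi x := G x 1 - G x 0.
pose f x := G 1 x - G 1 0 - phi x.
exists f, (fun x => g x - f x); split => [|x y|x]; last by rewrite addrC subrK.
- apply: locally_holder1_itv => [|M]; first exact: ltW.
  have [K1 K1_ge0 hK1] : exists2 K : R, 0 <= K & holder_itv alpha M K (G 1).
    by apply: is_derive_holder_itv (dG 1) _ => //; rewrite ltW.
  have [K2 K2_ge0 hK2] := holderF (Num.max M 1).
  have hphi : holder_itv alpha M K2 phi.
    apply: average_holder_itv dG _ => z /andP[z0 z1] x y xM yM.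
    by apply: hK2; rewrite le_max ?xM ?yM// ger0_norm// z1 orbT.
  exists (K1 + K2) => [|x y xM yM]; first exact: addr_ge0.
  have -> : f x - f y = (G 1 x - G 1 y) - (phi x - phi y) by rewrite /f; lra.
  apply: le_trans (ler_normB _ _) _.
  by rewrite mulrDl; apply: lerD; [exact: hK1|exact: hphi].
- have := cauchy_difference_average dG x y.
  by rewrite /cauchy_difference /f /phi; lra.
Qed.
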